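(* Let $1\le k\le n$ and $0\le \ell\le n$ be integers, and let $\mathcal{B}_\ell$ be the block diagonal matching field. Then the matching field ideal $J_{\mathcal{B}_\ell}$ is quadratically generated, i.e. it is generated by homogeneous polynomials of degree two in the variables $P_I$.
   Context: $\mathbb{K}$ is a field of characteristic $0$, $[n]=\{1,\dots,n\}$, and $\mathbf{I}_{k,n}$ is the set of $k$-element subsets of $[n]$. Block diagonal matching field: $\mathcal{B}_\ell:\mathbf{I}_{k,n}\to S_k$ is the map with $\mathcal{B}_\ell(I)=\mathrm{id}$ if $|I|=1$ or $|I\cap\{1,\dots,\ell\}|\neq 1$, and $\mathcal{B}_\ell(I)=(1\,2)$ otherwise. Matching field ideal: let $X=(x_{i,j})$ be a $k\times n$ matrix of indeterminates. For $I=\{i_1<\dots<i_k\}$ and $\sigma=\mathcal{B}_\ell(I)$ put $\mathbf{x}_{\mathcal{B}_\ell(I)}=x_{\sigma(1),i_1}x_{\sigma(2),i_2}\cdots x_{\sigma(k),i_k}$. The ideal $J_{\mathcal{B}_\ell}$ is the kernel of the $\mathbb{K}$-algebra map $\phi_{\mathcal{B}_\ell}:\mathbb{K}[P_I : I\in\mathbf{I}_{k,n}]\to\mathbb{K}[x_{i,j}]$, $P_I\mapsto \operatorname{sgn}(\mathcal{B}_\ell(I))\,\mathbf{x}_{\mathcal{B}_\ell(I)}$. *)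

(* Defs.v *)
From mathcomp Require Import all_boot all_order all_algebra all_fingroup.
From mathcomp Require Export mpoly.

Set Implicit Arguments.
Unset Strict Implicit.
Unset Printing Implicit Defensive.

Import GRing.Theory.
Local Open Scope ring_scope.

(* All index sets are 0-based: the element j of [n] is the element of 'I_n
   with value j - 1, and likewise for the row indices. *)

Definition ksub (k n : nat) := {I : {set 'I_n} | #|I| == k}.

(* The r-th smallest element of I: enum_val follows the increasing
   enumeration of 'I_n. *)
Definition ksub_nth (k n : nat) (I : ksub k n) (r : 'I_k) : 'I_n :=
  enum_val (cast_ord (esym (eqP (valP I))) r).

Definition matching_field (k n : nat) := ksub k n -> 'S_k.

(* The transposition (1 2), with a junk value for k <= 1. *)
Definition swap12 (k : nat) : 'S_k :=
  match k with
  | k'.+2 => tperm (ord0 : 'I_k'.+2) (lift ord0 ord0)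
  | _ => 1%g
  end.

(* With 0-based indices, {1, ..., l} is the set of i with i < l. *)
Definition block_diagonal (k n l : nat) : matching_field k n := fun I =>
  if (#|val I| == 1%N) || (#|val I :&: [set i : 'I_n | (i < l)%N]| != 1%N)
  then 1%g else swap12 k.

Arguments block_diagonal k n l I : clear implicits.

Section MatchingFieldIdeal.
Variables (K : fieldType) (k n : nat).

(* K[P_I : I in I_{k,n}]: the variable P_I is 'X_(enum_rank I). *)
Definition Pring := {mpoly K[#|{: ksub k n}|]}.

(* K[x_ij]: the k * n variables are indexed through mxvec_index. *)
Definition xring := {mpoly K[(k * n)%N]}.

Definition xvar (i : 'I_k) (j : 'I_n) : xring := 'X_(mxvec_index i j).

Definition matching_monomial (L : matching_field k n) (I : ksub k n) : xring :=
  \prod_(r < k) xvar (L I r) (ksub_nth I r).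

Definition matching_map (L : matching_field k n) (p : Pring) : xring :=
  mmap (@mpolyC (k * n)%N K)
    (fun a => let I := enum_val a in
              (-1) ^+ (L I : bool) * matching_monomial L I) p.

Definition matching_ideal (L : matching_field k n) (p : Pring) : Prop :=
  matching_map L p = 0.

End MatchingFieldIdeal.

Arguments matching_map K {k n} L p.
Arguments matching_ideal K {k n} L p.

Definition ideal_gen (R : comNzRingType) (G : R -> Prop) (p : R) : Prop :=
  exists2 s : seq (R * R),
    (forall u, u \in s -> G u.2) & p = \sum_(u <- s) u.1 * u.2.

Definition quadratically_generated (K : fieldType) (N : nat)
    (J : {mpoly K[N]} -> Prop) : Prop :=
  exists G : {mpoly K[N]} -> Prop,
    (forall g, G g -> g \is 2.-homog) /\ (forall p, J p <-> ideal_gen G p).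

(* Main.v *)
(* Write the monomial of each P_I as a column whose entry in row r is the j with
   x_(r,j) in the monomial. For B_l, the columns arising are the (a, b, c_3 < ...
   < c_k) with max(a, b) < c_3 and a before b in the order l+1, ..., n, 1, ..., l.
   As the ideal is toric up to signs, it suffices to connect any two tableaux with
   the same row contents by exchanges involving two columns. By induction on the
   number of columns, it is enough to make both tableaux share a column. If row 1
   contains an element p <= l, or row 2 contains none, take p minimal in row 1 and
   u minimal in row 2 with u > p: exchanges produce the head (p, u), whose maximum
   is minimal among all heads, so that it can then collect the minima of the other
   rows. Otherwise row 1 lies above l; its maximum x can be combined with the
   maximum of row 2 if this exceeds x and with the minimum of row 2 if not, the
   maximum of this head is maximal among all heads, and it can collect the maxima
   of the other rows. *)
Require Import Defs.
From mathcomp Require Import all_boot all_order all_algebra all_fingroup.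
From HB Require Import structures.
From mathcomp Require Import zify ring.

Set Implicit Arguments.
Unset Strict Implicit.
Unset Printing Implicit Defensive.

Import GRing.Theory.

(** * Columns of the block diagonal matching field *)

Section Columns.
Variables (k n : nat).
Implicit Types (I J : ksub k n) (f g : 'I_k -> 'I_n) (r s : 'I_k).

(** A strictly sorted list is determined by its elements. *)
Lemma increasing_eq_im f g :
  {homo f : r s / r < s} -> {homo g : r s / r < s} ->
  f @: setT = g @: setT -> f =1 g.
Proof.
have sorted_im (h : 'I_k -> 'I_n) : {homo h : r s / r < s} ->
    sorted ltn [seq val (h r) | r <- enum 'I_k].
  move=> hM; rewrite sorted_map.
  have := iota_ltn_sorted 0 k; rewrite -val_enum_ord sorted_map.
  by apply: sub_sorted => r s; apply: hM.
move=> fM gM fg r.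
have mem_im (h : 'I_k -> 'I_n) x : (x \in [seq val (h r) | r <- enum 'I_k]) =
    (x \in [seq val y | y <- enum (h @: setT)]).
  apply/mapP/mapP => -[y yP ->].
    by exists (h y); rewrite // mem_enum imset_f.
  move: yP; rewrite mem_enum => /imsetP[z _ ->].
  by exists z; rewrite ?mem_enum.
have /eq_in_map/(_ r) : [seq val (f r) | r <- enum 'I_k] =
    [seq val (g r) | r <- enum 'I_k].
  apply: (irr_sorted_eq ltn_trans ltnn); rewrite ?sorted_im// => x.
  by rewrite !mem_im fg.
by rewrite mem_enum => /(_ isT)/val_inj.
Qed.

Lemma ksub_nth_homo I : {homo ksub_nth I : r s / r < s}.
Proof.
move=> r s rs; set A := val I.
have srt : sorted ltn (map val (enum A)).
  rewrite sorted_map {1}/enum_mem -enumT.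
  apply: sorted_filter => [x y z|]; first exact: ltn_trans.
  by have := iota_ltn_sorted 0 n; rewrite -val_enum_ord sorted_map.
have sz : size (enum A) = k by rewrite -cardE; apply/eqP/(valP I).
have lt_sz (t : 'I_k) : t < size (enum A) by rewrite sz.
have E t : val (ksub_nth I t) = nth 0 (map val (enum A)) t.
  by rewrite /ksub_nth /enum_val (nth_map (ksub_nth I t)) //; congr val;
     apply: set_nth_default; rewrite /= lt_sz.
by rewrite !E; apply: (sorted_ltn_nth ltn_trans); rewrite // inE size_map.
Qed.

Lemma ksub_nth_im I : ksub_nth I @: setT = val I.
Proof.
apply/setP => x; apply/imsetP/idP => [[r _ ->]|xI]; first exact: enum_valP.
exists (cast_ord (eqP (valP I)) (enum_rank_in xI x)) => //.
by rewrite /ksub_nth cast_ordK enum_rankK_in.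
Qed.

Variable l : nat.

(* The strict order l, l+1, ..., n-1, 0, 1, ..., l-1. Putting the elements of I
   in the rows prescribed by the matching field, the swap of the first two makes
   the entries in the first two rows increasing exactly for this order. *)
Definition prec (x y : nat) := if l <= x then (y < l) || (x < y) else x < y < l.

(** [s] is the larger of two row indices, so [s == 1] singles out the comparison of rows 0 and 1. *)
Definition row_lt (s x y : nat) := if s == 1 then prec x y else x < y.

Definition admissible f :=
  forall r s, r < s -> row_lt s (f r) (f s).

(* [entry I r] is the j such that x_(r,j) divides the monomial of I. *)
Definition entry I r := ksub_nth I ((block_diagonal k n l I)^-1%g r).

Lemma entry_im I : entry I @: setT = val I.
Proof.
rewrite -ksub_nth_im; apply/setP => x; apply/imsetP/imsetP => -[r _ ->].
  by exists ((block_diagonal k n l I)^-1%g r).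
by exists (block_diagonal k n l I r); rewrite // /entry permK.
Qed.

Lemma entry_inj I J : entry I =1 entry J -> I = J.
Proof.
by move=> IJ; apply: val_inj; rewrite -!entry_im; apply: eq_imset.
Qed.

End Columns.

Lemma row_lt_neq l s x y : row_lt l s x y -> x != y.
Proof. by rewrite /row_lt /prec; case: (s == 1); [case: ifP|]; lia. Qed.

(** * Columns with at least two rows *)

Section LongColumns.
Variables (k n l : nat).
Local Notation K := k.+2.
Implicit Types (I J : ksub K n) (f g : 'I_K -> 'I_n) (r s : 'I_K).
Local Notation row0 := (ord0 : 'I_K).
Local Notation row1 := (lift ord0 ord0 : 'I_K).

(** The elements of [I] below [l] come first in its enumeration, so there is exactly one iff the
    smallest is below [l] and the second smallest is not. *)
Lemma block_diagonalE I : block_diagonal K n l I =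
  if (ksub_nth I row0 < l) && (l <= ksub_nth I row1) then tperm row0 row1
  else 1%g.
Proof.
rewrite /block_diagonal (eqP (valP I)) /=; set B := (_ :&: _).
have memB x : (x \in B) = (x \in val I) && (x < l) by rewrite !inE.
have inI r : ksub_nth I r \in val I by rewrite -ksub_nth_im imset_f.
have lt01 : ksub_nth I row0 < ksub_nth I row1 by apply: ksub_nth_homo.
suff -> : (#|B| == 1) = (ksub_nth I row0 < l <= ksub_nth I row1).
  by case: (_ && _).
apply/cards1P/andP => [[x Bx]|[lt0 lt1]]; last first.
  exists (ksub_nth I row0); apply/setP => x; rewrite memB inE.
  apply/andP/eqP => [[]|->]; last by rewrite inI.
  rewrite -ksub_nth_im => /imsetP[r _ ->] ltr.
  case: (posnP r) => [r0|r_gt0]; first by congr ksub_nth; apply: val_inj.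
  have : ~~ (row1 < r).
    by apply/negP => /(@ksub_nth_homo _ _ I); lia.
  rewrite -leqNgt /= /bump /= => r1.
  have e : r = row1 by apply: val_inj => /=; rewrite /bump /=; lia.
  by move: ltr; rewrite e; lia.
have : x \in B by rewrite Bx inE.
rewrite memB -{1}ksub_nth_im => /andP[/imsetP[r _ xr] ltx].
have le0 : ksub_nth I row0 <= x.
  rewrite xr; case: (posnP r) => [r0|r_gt0].
    by have -> : r = row0 by apply: val_inj.
  exact/ltnW/ksub_nth_homo.
split; first exact: leq_ltn_trans le0 ltx.
rewrite leqNgt; apply/negP => lt1.
have: ksub_nth I row1 \in B by rewrite memB inI lt1.
have: ksub_nth I row0 \in B by rewrite memB inI (leq_ltn_trans le0 ltx).
by rewrite Bx !inE => /eqP <- /eqP e; move: lt01; rewrite e ltnn.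
Qed.

Lemma row_cases r : [\/ r = row0, r = row1 | 1 < r].
Proof.
case: r => -[|[|r]] lt_r; [constructor 1|constructor 2|constructor 3] => //;
  exact: val_inj.
Qed.

Lemma admissibleP f : admissible l f <->
  [/\ prec l (f row0) (f row1),
      forall r, 1 < r -> (f row0 < f r) /\ (f row1 < f r)
    & forall r s, 1 < r -> r < s -> f r < f s].
Proof.
split=> [fP|[f01 f0 f2] r s].
  have lt2 r s : 1 < s -> r < s -> f r < f s.
    by move=> s1 rs; have := fP _ _ rs; rewrite /row_lt gtn_eqF.
  split=> [|r r1|r s r1 rs]; first exact: (fP row0 row1).
    by split; apply: lt2; rewrite //=; lia.
  by apply: lt2; lia.
rewrite /row_lt.
have [->|->|r1] := row_cases r; have [->|->|s1] := row_cases s => //= rs.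
- by rewrite gtn_eqF; have [] := f0 _ s1.
- by rewrite gtn_eqF; have [] := f0 _ s1.
- by move: rs r1; rewrite /bump /=; lia.
- by rewrite gtn_eqF //; apply: f2.
Qed.

Lemma entryE I r : entry l I r =
  ksub_nth I (if (ksub_nth I row0 < l) && (l <= ksub_nth I row1)
              then tperm row0 row1 r else r).
Proof.
rewrite /entry block_diagonalE.
by case: ifP => _; rewrite ?tpermV // invg1 perm1.
Qed.

Lemma tperm_gt1 r : 1 < r -> tperm row0 row1 r = r.
Proof.
by move=> r1; rewrite tpermD //; apply: contraTneq r1 => <-.
Qed.

(** A swap puts an element at least [l] before one below [l]; without a swap the first two lie on
    the same side of [l], where [prec] is the usual order. *)
Lemma entry_admissible I : admissible l (entry l I).
Proof.
have nthM r s : r < s -> ksub_nth I r < ksub_nth I s by apply: ksub_nth_homo.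
apply/admissibleP; rewrite !entryE.
have lt01 : ksub_nth I row0 < ksub_nth I row1 by apply: nthM.
split=> [|r r1|r s r1 rs]; last first.
- by rewrite !entryE !tperm_gt1 ?(ltn_trans r1 rs) ?if_same //; apply: nthM.
- rewrite !(entryE _ r) (tperm_gt1 r1) if_same.
  have lt0 : ksub_nth I row0 < ksub_nth I r by apply: nthM; rewrite /=; lia.
  have lt1 : ksub_nth I row1 < ksub_nth I r by apply: nthM.
  by case: ifP => _; rewrite ?tpermL ?tpermR.
case: ifP => E; rewrite ?tpermL ?tpermR; move: E lt01;
  move: (ksub_nth I row0) (ksub_nth I row1) => x y;
  by rewrite /prec; case: ifP; lia.
Qed.

(** Take the image of [f] as the set. A pair decreasing for the usual order satisfies [prec] only if
    it crosses [l], which is exactly when the matching field swaps. *)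
Lemma entry_surj f : admissible l f -> exists I, entry l I =1 f.
Proof.
move=> fP; have /admissibleP[f01 f0 f2] := fP.
have f_inj : injective f.
  move=> r s e; apply: val_inj; case: (ltngtP r s) => // /fP/row_lt_neq;
  by rewrite e eqxx.
have cardI : #|f @: setT| == K by rewrite card_imset // cardsT card_ord.
pose I : ksub K n := Sub (f @: setT) cardI.
pose sw := f row1 < f row0.
pose g r := f (if sw then tperm row0 row1 r else r).
have gM : {homo g : r s / r < s}.
  move=> r s; rewrite /g /sw; case: ifP => lt10;
  have [->|->|r1] := row_cases r; have [->|->|s1] := row_cases s;
    rewrite ?tpermL ?tpermR ?(tperm_gt1 r1) ?(tperm_gt1 s1) //=;
    rewrite ?ltnn //; try by rewrite /bump /=; lia.
  - by have [] := f0 _ s1.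
  - by have [] := f0 _ s1.
  - exact: f2.
  - move=> _; rewrite ltn_neqAle leqNgt lt10 andbT.
    exact: (row_lt_neq (fP row0 row1 _)).
  - by have [] := f0 _ s1.
  - by have [] := f0 _ s1.
  - exact: f2.
have nthE : ksub_nth I =1 g.
  apply: increasing_eq_im => //; first exact: ksub_nth_homo.
  rewrite ksub_nth_im /=; apply/setP => x.
  apply/imsetP/imsetP => -[r _ ->].
    exists (if sw then tperm row0 row1 r else r) => //.
    by rewrite /g; case: (sw); rewrite ?tpermK.
  by exists (if sw then tperm row0 row1 r else r).
exists I => r; rewrite entryE !nthE.
have -> : (g row0 < l) && (l <= g row1) = sw.
  have := row_lt_neq (fP row0 row1 isT).
  rewrite /g /sw; move: f01; rewrite /prec.
  case: (ltnP (f row1) (f row0)) => lt10; rewrite ?tpermL ?tpermR;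
    by case: ifP; lia.
by rewrite /g; case: (sw); rewrite ?tpermK.
Qed.

End LongColumns.

(** * Exchanges between two columns *)

Lemma seq_argmin (X : eqType) (F : X -> nat) (P : pred X) (T : seq X) x0 :
  x0 \in T -> P x0 ->
  exists x, [/\ x \in T, P x & forall y, y \in T -> P y -> F x <= F y].
Proof.
elim: T x0 => // a T IH x0; rewrite in_cons => x0T Px0.
have [/hasP[x xT Px]|/hasPn noP] := boolP (has P T).
  have {IH}[y [yT Py ymin]] := IH x xT Px.
  case: (boolP (P a && (F a < F y))) => [/andP[Pa lt_ay]|aF].
    exists a; split=> [||z]; rewrite ?mem_head // in_cons.
    move=> /orP[/eqP-> //|zT Pz].
    exact: leq_trans (ltnW lt_ay) (ymin z zT Pz).
  exists y; split=> [||z]; rewrite ?in_cons ?yT ?orbT //.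
  move=> /orP[/eqP-> Pa|zT Pz]; last exact: ymin.
  by move: aF; rewrite Pa -leqNgt.
have x0a : x0 = a.
  by case/orP: x0T => [/eqP//|/noP/negP].
exists a; split=> [||z]; rewrite ?mem_head -?x0a // in_cons.
by case/orP=> [/eqP-> //|/noP/negP].
Qed.

Section Connectivity.
Variables (k n l : nat).
Implicit Types (I J C D : ksub k n) (T : seq (ksub k n)) (r : 'I_k).

(* Lists of k-subsets stand for monomials in the P_I, as the lists of columns of
   a tableau; two of them have the same image under the matching field map, up
   to sign, iff their rows agree as multisets. *)
Definition same_rows T T' :=
  forall r, perm_eq [seq entry l D r | D <- T] [seq entry l D r | D <- T'].

(** Columns stand for commuting variables, so reordering is free; only exchanges inside a pair use
    quadratic binomials. *)
Inductive quad_conn : seq (ksub k n) -> seq (ksub k n) -> Prop :=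
| quad_conn_perm T T' : perm_eq T T' -> quad_conn T T'
| quad_conn_pair I J I' J' T : same_rows [:: I; J] [:: I'; J'] ->
    quad_conn [:: I, J & T] [:: I', J' & T]
| quad_conn_trans T1 T2 T3 :
    quad_conn T1 T2 -> quad_conn T2 T3 -> quad_conn T1 T3.

Lemma quad_conn_cons I T T' : quad_conn T T' -> quad_conn (I :: T) (I :: T').
Proof.
elim=> {T T'} [T T' TT'|J1 J2 J1' J2' T JJ|T1 T2 T3 _ T12 _ T23].
- by apply: quad_conn_perm; rewrite perm_cons.
- have rot3 J J' : perm_eq [:: I, J, J' & T] [:: J, J', I & T].
    by apply/seq.permP => p /=; lia.
  apply: quad_conn_trans (quad_conn_perm (rot3 _ _)) _.
  apply: quad_conn_trans (quad_conn_pair _ JJ) (quad_conn_perm _).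
  by rewrite perm_sym.
- exact: quad_conn_trans T12 T23.
Qed.

Lemma quad_conn_sym T T' : quad_conn T T' -> quad_conn T' T.
Proof.
elim=> {T T'} [T T' TT'|J1 J2 J1' J2' T JJ|T1 T2 T3 _ T12 _ T23].
- by apply: quad_conn_perm; rewrite perm_sym.
- by apply: quad_conn_pair => r; rewrite perm_sym.
- exact: quad_conn_trans T23 T12.
Qed.

Lemma quad_conn_rows T T' : quad_conn T T' -> same_rows T T'.
Proof.
elim=> {T T'} [T T' TT'|J1 J2 J1' J2' T JJ|T1 T2 T3 _ T12 _ T23] r.
- exact: perm_map.
- by have := JJ r; rewrite -(perm_cat2r [seq entry l D r | D <- T]).
- exact: perm_trans (T12 r) (T23 r).
Qed.

Lemma same_rows_mem T T' D r : same_rows T T' -> D \in T' ->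
  exists2 E, E \in T & entry l E r = entry l D r.
Proof.
move=> /(_ r) TT' DT'.
have : entry l D r \in [seq entry l D r | D <- T].
  by rewrite (perm_mem TT'); apply: map_f.
by case/mapP => E ET ->; exists E.
Qed.

Definition mix (sw : pred 'I_k) I J r :=
  if sw r then entry l J r else entry l I r.

Lemma same_rows_mix (sw : pred 'I_k) I J I' J' :
    entry l I' =1 mix sw I J -> entry l J' =1 mix sw J I ->
  same_rows [:: I; J] [:: I'; J'].
Proof.
move=> I'E J'E r; rewrite /= I'E J'E /mix.
by case: (sw r) => //; apply/seq.permP => p /=; lia.
Qed.

End Connectivity.

(** * Peeling off a column *)

Section SweepTails.
Variables (k n l : nat).
Local Notation K := k.+2.
Implicit Types (I J C D : ksub K n) (T : seq (ksub K n)) (r : 'I_K).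
Local Notation row0 := (ord0 : 'I_K).
Local Notation row1 := (lift ord0 ord0 : 'I_K).
Local Notation entry := (entry l).
Local Notation quad_conn := (quad_conn l).
Local Notation same_rows := (same_rows l).

(** Admissibility makes both mixtures columns of actual subsets, and mixing preserves the rows. *)
Lemma quad_conn_mix (sw : pred 'I_K) I J T :
    admissible l (mix l sw I J) -> admissible l (mix l sw J I) ->
  exists I' J', [/\ entry I' =1 mix l sw I J, entry J' =1 mix l sw J I
    & quad_conn [:: I, J & T] [:: I', J' & T]].
Proof.
move=> /entry_surj[I' I'E] /entry_surj[J' J'E]; exists I', J'; split=> //.
by apply: quad_conn_pair; apply: same_rows_mix I'E J'E.
Qed.

(* The head of a column is its pair of entries in rows 0 and 1, the tail
   consists of the other ones. Heads and tails may be recombined freely as long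
   as the entry of row 2 exceeds [top]. *)
Definition top I := maxn (entry I row0) (entry I row1).

(** The flag lets one argument collect minima ([false]) and maxima ([true]). *)
Definition cmp (up : bool) (x y : nat) := if up then y <= x else x <= y.

(** Rowwise minima and maxima of two increasing tails are increasing. Since the head of [C] has the
    extremal [top], both heads stay below their new tails. *)
Lemma sweep_tails up C T :
    (forall D, D \in T -> cmp up (top C) (top D)) ->
  exists C' T', [/\ quad_conn (C :: T) (C' :: T'),
    entry C' row0 = entry C row0 /\ entry C' row1 = entry C row1,
    forall r, 1 < r -> cmp up (entry C' r) (entry C r)
    & forall D r, D \in T' -> 1 < r -> cmp up (entry C' r) (entry D r)].
Proof.
elim: T C => [|D T IH] C topC.
  exists C, [::]; split=> // [|r _]; first exact: quad_conn_perm.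
  by case: up {topC}; rewrite /cmp.
(* Exchange the tail rows in which [D] strictly beats [C]. *)
pose sw r := (1 < r) && ~~ cmp up (entry C r) (entry D r).
have topCD : cmp up (top C) (top D) by apply: topC; rewrite mem_head.
have /admissibleP[C01 C0 C2] := @entry_admissible _ _ l C.
have /admissibleP[D01 D0 D2] := @entry_admissible _ _ l D.
have [||C1 [D1 [C1E D1E CD1]]] := @quad_conn_mix sw C D T.
- apply/admissibleP; split=> [|r r1|r s r1 rs]; rewrite /mix /sw //= ?r1.
    have := C0 r r1; have := D0 r r1; move: topCD; rewrite /top /cmp.
    by case: up {IH topC sw}; case: ifP; lia.
  rewrite (ltn_trans r1 rs); move: (C2 r s r1 rs) (D2 r s r1 rs).
  by rewrite /cmp; case: up {IH topC sw topCD}; do 2!case: ifP; lia.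
- apply/admissibleP; split=> [|r r1|r s r1 rs]; rewrite /mix /sw //= ?r1.
    have := C0 r r1; have := D0 r r1; move: topCD; rewrite /top /cmp.
    by case: up {IH topC sw}; case: ifP; lia.
  rewrite (ltn_trans r1 rs); move: (C2 r s r1 rs) (D2 r s r1 rs).
  by rewrite /cmp; case: up {IH topC sw topCD}; do 2!case: ifP; lia.
have C1_0 : entry C1 row0 = entry C row0 by rewrite C1E.
have C1_1 : entry C1 row1 = entry C row1 by rewrite C1E.
have [|C' [T' [conn [e0 e1] leC' leT']]] := IH C1.
  move=> E ET; rewrite /top C1_0 C1_1; apply: topC.
  by rewrite in_cons ET orbT.
have perm2 (X Y : ksub K n) S : perm_eq [:: X, Y & S] [:: Y, X & S].
  by apply/seq.permP => p /=; lia.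
exists C', (D1 :: T'); split.
- apply: quad_conn_trans CD1 _.
  apply: quad_conn_trans (quad_conn_perm _ (perm2 _ _ _)) _.
  apply: quad_conn_trans (quad_conn_cons D1 conn) _.
  exact: quad_conn_perm (perm2 _ _ _).
- by rewrite e0 e1.
- move=> r r1; have := leC' r r1; rewrite C1E /mix /sw r1 /= /cmp.
  by case: up {sw C1E D1E leC' leT' IH topC topCD}; case: ifP; lia.
move=> E r; rewrite in_cons => /orP[/eqP->|ET] r1; last exact: leT'.
have := leC' r r1; rewrite C1E D1E /mix /sw r1 /= /cmp.
by case: up {sw C1E D1E leC' leT' IH topC topCD}; case: ifP; lia.
Qed.

End SweepTails.

(** * Peeling off a column determined by the row contents *)

Section CommonColumn.
Variables (k n l : nat).
Local Notation K := k.+2.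
Implicit Types (I J C D : ksub K n) (T : seq (ksub K n)) (r : 'I_K).
Local Notation row0 := (ord0 : 'I_K).
Local Notation row1 := (lift ord0 ord0 : 'I_K).
Local Notation entry := (entry l).
Local Notation quad_conn := (quad_conn l).
Local Notation same_rows := (same_rows l).

Lemma entry_bounds I :
  [/\ prec l (entry I row0) (entry I row1),
      forall r, 1 < r -> entry I row0 < entry I r /\ entry I row1 < entry I r
    & forall r s : 'I_K, 1 < r -> r < s -> entry I r < entry I s].
Proof. exact/admissibleP/entry_admissible. Qed.

(** The [prec] hypotheses order the new heads; the bounds by [top] keep each head below its tail. *)
Lemma swap_row0 I J T :
    prec l (entry J row0) (entry I row1) ->
    prec l (entry I row0) (entry J row1) ->
    entry J row0 <= top l I -> entry I row0 <= top l J ->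
  exists I' J', [/\ entry I' row0 = entry J row0, entry I' row1 = entry I row1
    & quad_conn [:: I, J & T] [:: I', J' & T]].
Proof.
move=> JI IJ leI leJ; pose sw r := r == row0.
have [I01 I0 I2] := entry_bounds I; have [J01 J0 J2] := entry_bounds J.
have sw2 r : 1 < r -> sw r = false by case: r => -[].
have [||I' [J' [I'E J'E IJ']]] := @quad_conn_mix _ _ l sw I J T.
- apply/admissibleP; split=> [//|r r1|r s r1 rs]; last first.
    by rewrite /mix !sw2 ?(ltn_trans r1 rs) //; apply: I2.
  rewrite /mix (sw2 r r1) /=.
  by have := I0 r r1; move: leI; rewrite /top; lia.
- apply/admissibleP; split=> [//|r r1|r s r1 rs]; last first.
    by rewrite /mix !sw2 ?(ltn_trans r1 rs) //; apply: J2.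
  rewrite /mix (sw2 r r1) /=.
  by have := J0 r r1; move: leJ; rewrite /top; lia.
by exists I', J'; split=> //; rewrite I'E.
Qed.

Lemma swap_row1 I J T :
    prec l (entry I row0) (entry J row1) ->
    prec l (entry J row0) (entry I row1) ->
    entry J row1 <= top l I -> entry I row1 <= top l J ->
  exists I' J', [/\ entry I' row0 = entry I row0, entry I' row1 = entry J row1
    & quad_conn [:: I, J & T] [:: I', J' & T]].
Proof.
move=> JI IJ leI leJ; pose sw r := r == row1.
have [I01 I0 I2] := entry_bounds I; have [J01 J0 J2] := entry_bounds J.
have sw2 r : 1 < r -> sw r = false by case: r => -[|[]].
have [||I' [J' [I'E J'E IJ']]] := @quad_conn_mix _ _ l sw I J T.
- apply/admissibleP; split=> [//|r r1|r s r1 rs]; last first.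
    by rewrite /mix !sw2 ?(ltn_trans r1 rs) //; apply: I2.
  rewrite /mix (sw2 r r1) /=.
  by have := I0 r r1; move: leI; rewrite /top; lia.
- apply/admissibleP; split=> [//|r r1|r s r1 rs]; last first.
    by rewrite /mix !sw2 ?(ltn_trans r1 rs) //; apply: J2.
  rewrite /mix (sw2 r r1) /=.
  by have := J0 r r1; move: leJ; rewrite /top; lia.
by exists I', J'; split=> //; rewrite I'E.
Qed.

Lemma perm_two I J T : I \in T -> J \in T -> entry I row1 != entry J row1 ->
  exists T', perm_eq T [:: I, J & T'].
Proof.
move=> IT JT neq; exists (rem J (rem I T)).
have JT' : J \in rem I T.
  have: J \in I :: rem I T by rewrite -(perm_mem (perm_to_rem IT)).
  by rewrite in_cons => /orP[/eqP e|//]; rewrite e eqxx in neq.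
apply: perm_trans (perm_to_rem IT) _.
by rewrite perm_cons perm_to_rem.
Qed.

(* If [peel_low T], the column with head [p = min] of row 0 and
   [u = min {b in row 1 | p < b}] can be split off, and [u] is then the
   smallest head maximum occurring in [T]. Otherwise row 0 lies above [l], and
   the column starting with the maximum of row 0 has the largest head
   maximum. *)
Definition peel_low T :=
  has (fun D => entry D row0 < l) T || all (fun D => l <= entry D row1) T.

(** Depends on [T] only through the contents of rows 0 and 1, hence is invariant under exchanges. *)
Definition low_head C T :=
  [/\ entry C row0 < entry C row1,
      forall D, D \in T -> entry C row0 <= entry D row0
    & forall D, D \in T -> entry C row0 < entry D row1 ->
        entry C row1 <= entry D row1].

Definition high_head C T :=
  (forall D, D \in T -> entry D row0 <= entry C row0) /\
  (entry C row0 < entry C row1 /\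
     (forall D, D \in T -> entry D row1 <= entry C row1) \/
   (forall D, D \in T ->
      entry D row1 <= entry C row0 /\ entry C row1 <= entry D row1)).

Lemma low_head_conn T : T != [::] -> peel_low T ->
  exists C T', quad_conn T (C :: T') /\ low_head C T.
Proof.
case: T => // I0 T0; set T := I0 :: T0 => _ lowT.
have [I [IT _ Imin]] := @seq_argmin _ (fun D => entry D row0 : nat) predT T I0
  (mem_head _ _) isT.
have [I01 _ _] := entry_bounds I.
(* The head of [I] cannot wrap around from above [l] to below it, so a candidate for [u] exists. *)
have I0lt1 : entry I row0 < entry I row1.
  case/orP: lowT => [/hasP[D DT ltD]|/allP/(_ I IT) leI].
    have leID := leq_trans (Imin D DT isT) (ltnW ltD).
    by have := Imin D DT isT; move: I01; rewrite /prec; case: ifP; lia.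
  by move: I01; rewrite /prec; case: ifP; lia.
have [E [ET ltE Emin]] := @seq_argmin _ (fun D => entry D row1 : nat)
  (fun D => entry I row0 < entry D row1) T I IT I0lt1.
have [E01 _ _] := entry_bounds E.
have EI := Emin I IT I0lt1; have I0E0 := Imin E ET isT.
have [e|neq] := eqVneq (entry E row1) (entry I row1).
  exists I, (rem I T); split; first exact/quad_conn_perm/perm_to_rem.
  split=> // D DT; first exact: Imin.
  by rewrite -e; apply: Emin.
suff [C [T' [C0 C1 CT]]] : exists C T', [/\ entry C row0 = entry I row0,
    entry C row1 = entry E row1 & quad_conn T (C :: T')].
  exists C, T'; split=> //; split; rewrite C0 ?C1 // => D DT.
  exact: Imin.
(* Either exchange gives the heads [(p, u)] and [(entry E row0, entry I row1)]. If the head of [E]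
   wraps around [l], the second head needs the tail of [E], otherwise that of [I]. *)
have [EL|EL] := boolP ((l <= entry E row0) && (entry E row1 < l)).
  have [|T1 perm1] := @perm_two I E T IT ET; first by rewrite eq_sym.
  have [||||C [J [C0 C1 CJ]]] := @swap_row1 I E T1; rewrite /top.
  - by move: I01 E01; rewrite /prec; do 2!case: ifP; lia.
  - by move: I01 E01; rewrite /prec; do 2!case: ifP; lia.
  - by lia.
  - by move: I01 E01; rewrite /prec; do 2!case: ifP; lia.
  exists C, (J :: T1); split=> //.
  exact: quad_conn_trans (quad_conn_perm _ perm1) CJ.
have [//|T1 perm1] := @perm_two E I T ET IT.
have [||||C [J [C0 C1 CJ]]] := @swap_row0 E I T1; rewrite /top.
- by move: I01 E01; rewrite /prec; do 2!case: ifP; lia.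
- by move: I01 E01; rewrite /prec; do 2!case: ifP; lia.
- by lia.
- by move: I01 E01; rewrite /prec; do 2!case: ifP; lia.
exists C, (J :: T1); split=> //.
exact: quad_conn_trans (quad_conn_perm _ perm1) CJ.
Qed.

Lemma high_head_conn T : T != [::] -> ~~ peel_low T ->
  exists C T', quad_conn T (C :: T') /\ high_head C T.
Proof.
case: T => // I0 T0; set T := I0 :: T0 => _.
rewrite negb_or -all_predC -has_predC => /andP[/allP geT /hasP[B BT ltB]].
have lt_n (x : 'I_n) : x < n by [].
have argmax r : exists2 D, D \in T &
    forall D', D' \in T -> entry D' r <= entry D r.
  have [D [DT _ Dmin]] := @seq_argmin _ (fun D => n - entry D r) predT T I0
    (mem_head _ _) isT.
  exists D => // D' /Dmin/(_ isT).
  by have := lt_n (entry D r); have := lt_n (entry D' r); lia.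
have [I IT Imax] := argmax row0; have [E ET Emax] := argmax row1.
have [I01 _ _] := entry_bounds I; have [E01 _ _] := entry_bounds E.
have EI := Emax I IT; have IE := Imax E ET.
have /= := geT I IT; have /= := geT E ET; rewrite -!leqNgt => leE leI.
have [ltIE|leEI] := ltnP (entry I row0) (entry E row1).
  have [e|neq] := eqVneq (entry E row1) (entry I row1).
    exists I, (rem I T); split; first exact/quad_conn_perm/perm_to_rem.
    split=> //; left; rewrite -e; split=> //.
  have [//|T1 perm1] := @perm_two E I T ET IT.
  have [||||C [J [C0 C1 CJ]]] := @swap_row0 E I T1; rewrite /top.
  - by move: I01 E01; rewrite /prec; do 2!case: ifP; lia.
  - by move: I01 E01; rewrite /prec; do 2!case: ifP; lia.
  - by lia.
  - by lia.
  exists C, (J :: T1); split.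
    exact: quad_conn_trans (quad_conn_perm _ perm1) CJ.
  by split; rewrite C0 //; left; rewrite C1.
(* Row 1 never exceeds the maximum of row 0 here, so the head of [I] wraps and its row 1 entry lies
   below [l]; so does the minimum in [F], by comparison with [B]. *)
have [F [FT _ Fmin]] := @seq_argmin _ (fun D => entry D row1 : nat) predT T I0
  (mem_head _ _) isT.
have FB := Fmin B BT isT; have FI := Fmin I IT isT.
have /= := geT F FT; rewrite -leqNgt => leF.
have [e|neq] := eqVneq (entry I row1) (entry F row1).
  exists I, (rem I T); split; first exact/quad_conn_perm/perm_to_rem.
  split=> //; right => D DT; rewrite e; split; last exact: Fmin.
  exact: leq_trans (Emax D DT) leEI.
move: ltB => /=; rewrite -ltnNge => ltB.
have [//|T1 perm1] := @perm_two I F T IT FT.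
have [||||C [J [C0 C1 CJ]]] := @swap_row1 I F T1; rewrite /top.
- by move: I01 E01; rewrite /prec; do 2!case: ifP; lia.
- by move: I01; rewrite /prec; do 2!case: ifP; lia.
- by lia.
- by move: I01; rewrite /prec; case: ifP; lia.
exists C, (J :: T1); split.
  exact: quad_conn_trans (quad_conn_perm _ perm1) CJ.
split; rewrite C0 //; right => D DT; rewrite C1; split; last exact: Fmin.
exact: leq_trans (Emax D DT) leEI.
Qed.

Lemma same_rows_peel_low T T' : same_rows T T' -> peel_low T = peel_low T'.
Proof.
move=> TT'; rewrite /peel_low; congr (_ || _).
  rewrite -[LHS](has_map (fun D => entry D row0) (fun x : 'I_n => x < l)).
  rewrite -[RHS](has_map (fun D => entry D row0) (fun x : 'I_n => x < l)).
  by rewrite (eq_has_r (perm_mem (TT' row0))).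
rewrite -[LHS](all_map (fun D => entry D row1) (fun x : 'I_n => l <= x)).
rewrite -[RHS](all_map (fun D => entry D row1) (fun x : 'I_n => l <= x)).
by rewrite (eq_all_r (perm_mem (TT' row1))).
Qed.

Lemma same_rows_low_head C C' T T' : same_rows T T' ->
    entry C' row0 = entry C row0 -> entry C' row1 = entry C row1 ->
  low_head C T -> low_head C' T'.
Proof.
move=> TT' e0 e1 [C01 C0 C1]; split=> [|D DT'|D DT']; rewrite ?e0 ?e1 //.
  by have [E ET <-] := same_rows_mem row0 TT' DT'; apply: C0.
by have [E ET <-] := same_rows_mem row1 TT' DT'; apply: C1.
Qed.

Lemma same_rows_high_head C C' T T' : same_rows T T' ->
    entry C' row0 = entry C row0 -> entry C' row1 = entry C row1 ->
  high_head C T -> high_head C' T'.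
Proof.
move=> TT' e0 e1 [C0 C1]; split=> [D DT'|]; rewrite ?e0 ?e1.
  by have [E ET <-] := same_rows_mem row0 TT' DT'; apply: C0.
case: C1 => [[C01 C1]|C1]; [left; split=> // D DT'|right => D DT'];
  by have [E ET <-] := same_rows_mem row1 TT' DT'; apply: C1.
Qed.

(** Testing each head against the other tableau gives both inequalities. *)
Lemma low_head_uniq C C' T T' : C \in T -> C' \in T' ->
    low_head C T' -> low_head C' T ->
  entry C row0 = entry C' row0 /\ entry C row1 = entry C' row1.
Proof.
move=> CT C'T [C01 C0 C1] [C'01 C'0 C'1].
have e0 : entry C row0 = entry C' row0.
  by apply/val_inj/eqP; rewrite eqn_leq C0 ?C'0.
split=> //; apply/val_inj/eqP; rewrite eqn_leq C1 ?C'1 //.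
  by rewrite -e0.
by rewrite e0.
Qed.

Lemma high_head_uniq C C' T T' : C \in T -> C' \in T' ->
    high_head C T' -> high_head C' T ->
  entry C row0 = entry C' row0 /\ entry C row1 = entry C' row1.
Proof.
move=> CT C'T [C0 C1] [C'0 C'1].
have e0 : entry C row0 = entry C' row0.
  by apply/val_inj/eqP; rewrite eqn_leq C0 ?C'0.
split=> //; apply/val_inj/eqP; rewrite eqn_leq.
(* In the mixed cases one head increases while the other bounds row 1 by the same entry of row 0, a
   contradiction. *)
case: C1 C'1 => [[C01 C1]|C1] [[C'01 C'1]|C'1].
- by rewrite C1 ?C'1.
- by have [] := C'1 C CT; rewrite -e0 leqNgt C01.
- by have [] := C1 C' C'T; rewrite e0 leqNgt C'01.
- by have [_ ->] := C1 C' C'T; have [_ ->] := C'1 C CT.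
Qed.

(** Let [(p, u)] be the head of [C]. A row 1 entry above [p] is at least [u]. If that of [D] is not
    above [p], then [D] wraps, so [peel_low] forces [p < l] and hence [u < l <= entry D row0]. *)
Lemma low_head_top C T D : peel_low T -> C \in T -> D \in T ->
  low_head C T -> top l C <= top l D.
Proof.
move=> lowT CT DT [C01 C0 C1].
have := C0 D DT; have := C1 D DT.
have [C_prec _ _] := entry_bounds C; have [D_prec _ _] := entry_bounds D.
move: C_prec D_prec; rewrite /prec /top; case/orP: lowT => [/hasP[E ET ltE]|].
  by have := C0 E ET; move: ltE => /=; do 2!case: ifP; lia.
by move=> /allP geT; have := geT D DT; move=> /=; do 2!case: ifP; lia.
Qed.

Lemma high_head_top C T D : D \in T -> high_head C T ->
  top l D <= top l C.
Proof.
move=> DT [C0 C1]; have := C0 D DT; rewrite /top.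
by case: C1 => [[C01 /(_ D DT)]|/(_ D DT)]; lia.
Qed.

Lemma peel_column T : T != [::] -> exists C T', [/\ quad_conn T (C :: T'),
  if peel_low T then low_head C (C :: T') else high_head C (C :: T')
  & forall D r, D \in C :: T' -> 1 < r ->
      cmp (~~ peel_low T) (entry C r) (entry D r)].
Proof.
move=> T0; have [C [T1 [TC headC]]] : exists C T1, quad_conn T (C :: T1) /\
    if peel_low T then low_head C T else high_head C T.
  by case: (boolP (peel_low T)); [apply: low_head_conn | apply: high_head_conn].
have TC_rows := quad_conn_rows TC; have eT := same_rows_peel_low TC_rows.
have [D DT1|C' [T2 [CC' [e0 e1] _ tailC']]] :=
    @sweep_tails _ _ l (~~ peel_low T) C T1.
  have CT : C \in C :: T1 := mem_head _ _.
  have DT : D \in C :: T1 by rewrite in_cons DT1 orbT.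
  rewrite /cmp; move: headC; case: ifP => lowT headC /=.
    apply: low_head_top CT DT _; first by rewrite -eT.
    exact: same_rows_low_head TC_rows _ _ headC.
  apply: high_head_top DT _.
  exact: same_rows_high_head TC_rows _ _ headC.
have TC' := quad_conn_trans TC CC'; exists C', T2; split=> //.
  have TC'_rows := quad_conn_rows TC'.
  move: headC; case: ifP => _ headC.
    exact: same_rows_low_head TC'_rows e0 e1 headC.
  exact: same_rows_high_head TC'_rows e0 e1 headC.
move=> D r; rewrite in_cons => /orP[/eqP->|DT2] r1; last exact: tailC'.
by rewrite /cmp; case: (~~ _).
Qed.

(** The peeled column depends only on the row contents: its head is unique, and its other entries
    are row minima or row maxima. *)
Lemma same_rows_common_column T T' : T != [::] -> T' != [::] ->
    same_rows T T' ->
  exists C T1 T1', quad_conn T (C :: T1) /\ quad_conn T' (C :: T1').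
Proof.
move=> T0 T'0 TT'; have eTT' := same_rows_peel_low TT'.
have [C [T1 [TC headC tailC]]] := peel_column T0.
have [C' [T1' [TC' headC' tailC']]] := peel_column T'0.
suff CC' : C = C' by exists C, T1, T1'; rewrite {2}CC'.
move: headC' tailC'; rewrite -eTT' => headC' tailC'.
have CT : C \in C :: T1 := mem_head _ _.
have C'T' : C' \in C' :: T1' := mem_head _ _.
have rows : same_rows (C :: T1) (C' :: T1').
  move=> r; rewrite -(permPl (quad_conn_rows TC r)).
  exact: perm_trans (TT' r) (quad_conn_rows TC' r).
have rows' : same_rows (C' :: T1') (C :: T1) by move=> r; rewrite perm_sym.
have [e0 e1] : entry C row0 = entry C' row0 /\ entry C row1 = entry C' row1.
  move: headC headC'; case: ifP => _ headC headC'.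
    apply: low_head_uniq CT C'T' _ _.
      exact: same_rows_low_head rows _ _ headC.
    exact: same_rows_low_head rows' _ _ headC'.
  apply: high_head_uniq CT C'T' _ _.
    exact: same_rows_high_head rows _ _ headC.
  exact: same_rows_high_head rows' _ _ headC'.
apply: (@entry_inj _ _ l) => r; have [->|->|r1] := row_cases r => //.
have [E ET eE] := same_rows_mem r rows C'T'.
have [E' ET' eE'] := same_rows_mem r rows' CT.
have := tailC E r ET r1; have := tailC' E' r ET' r1; rewrite eE eE' /cmp.
by case: (~~ _) => le le'; apply/val_inj/eqP; rewrite eqn_leq le le'.
Qed.

End CommonColumn.

(** * Connectivity for every positive number of rows *)

Lemma same_rows_size k n l (T T' : seq (ksub k n)) :
  0 < k -> same_rows l T T' -> size T = size T'.
Proof.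
move=> k0 /(_ (Ordinal k0))/perm_size.
by rewrite !size_map.
Qed.

(** With one row a column is its single entry, so any column of [T'] already occurs in [T]. *)
Lemma same_rows_common k n l (T T' : seq (ksub k n)) : 0 < k ->
    T != [::] -> T' != [::] -> same_rows l T T' ->
  exists C T1 T1', quad_conn l T (C :: T1) /\ quad_conn l T' (C :: T1').
Proof.
case: k T T' => [|[|k]] T T' // _; last exact: same_rows_common_column.
move=> _; case: T' => // C T' _ TT'.
have [E ET eE] := same_rows_mem ord0 TT' (mem_head _ _).
have CE : C = E by apply: (@entry_inj _ _ l) => r; rewrite ord1.
exists C, (rem C T), T'; split; last exact: quad_conn_perm.
by apply/quad_conn_perm/perm_to_rem; rewrite CE.
Qed.

Theorem same_rows_quad_conn k n l (T T' : seq (ksub k n)) : 0 < k ->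
  same_rows l T T' -> quad_conn l T T'.
Proof.
move=> k0; elim: {T}(size T) {-2}T (erefl (size T)) T' => [|d IH] T sT T' TT'.
  have := same_rows_size k0 TT'; rewrite sT => /esym/size0nil ->.
  by rewrite (size0nil sT); apply: quad_conn_perm.
have sT' := same_rows_size k0 TT'.
have T0 : T != [::] by rewrite -size_eq0 sT.
have T'0 : T' != [::] by rewrite -size_eq0 -sT' sT.
have [C [T1 [T1' [TC TC']]]] := same_rows_common k0 T0 T'0 TT'.
apply: (quad_conn_trans TC); apply: (quad_conn_trans _ (quad_conn_sym TC')).
have := same_rows_size k0 (quad_conn_rows TC); rewrite sT => -[/esym sT1].
(* Cancelling the entry of [C] in every row leaves equal row contents. *)
apply/quad_conn_cons/IH => // r; rewrite -(perm_cons (entry l C r)).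
rewrite -(permPl (quad_conn_rows TC r)).
exact: perm_trans (TT' r) (quad_conn_rows TC' r).
Qed.

(** * From tableaux to the ideal *)

Local Open Scope ring_scope.

Section IdealGen.
Variables (R : comNzRingType) (G : R -> Prop).

Lemma ideal_gen0 : ideal_gen G 0.
Proof. by exists [::]; rewrite ?big_nil. Qed.

Lemma ideal_gen_mem g : G g -> ideal_gen G g.
Proof.
move=> Gg; exists [:: (1, g)]; last by rewrite big_seq1 mul1r.
by move=> u; rewrite inE => /eqP->.
Qed.

Lemma ideal_genD p q : ideal_gen G p -> ideal_gen G q -> ideal_gen G (p + q).
Proof.
move=> [s sG ->] [t tG ->]; exists (s ++ t); last by rewrite big_cat.
by move=> u; rewrite mem_cat => /orP[/sG|/tG].
Qed.

Lemma ideal_genM a p : ideal_gen G p -> ideal_gen G (a * p).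
Proof.
move=> [s sG ->]; exists [seq (a * u.1, u.2) | u <- s].
  by move=> _ /mapP[u us ->]; apply: sG us.
by rewrite big_map mulr_sumr; apply: eq_bigr => u _; rewrite mulrA.
Qed.

Lemma ideal_gen_sum (I : Type) (s : seq I) (F : I -> R) :
  (forall i, ideal_gen G (F i)) -> ideal_gen G (\sum_(i <- s) F i).
Proof.
move=> FG; elim/big_rec: _ => [|i p _]; first exact: ideal_gen0.
exact: ideal_genD.
Qed.

End IdealGen.

(** Distinct monomials are linearly independent, so the coefficients over each exponent sum to zero,
    whatever vectors [R] attaches to the exponents. *)
Lemma mpolyX_relation (K : fieldType) (N : nat) (V : lmodType K) (I : eqType)
    (s : seq I) (c : I -> K) (w : I -> 'X_{1..N}) (R : 'X_{1..N} -> V) :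
    \sum_(i <- s) c i *: 'X_[w i] = 0 :> {mpoly K[N]} ->
  \sum_(i <- s) c i *: R (w i) = 0.
Proof.
move=> rel0; pose W := undup [seq w i | i <- s].
transitivity (\sum_(i <- s) \sum_(v <- W) (c i * (w i == v)%:R) *: R v).
  apply: eq_big_seq => i si.
  have wiW : w i \in W by rewrite mem_undup map_f.
  rewrite (bigD1_seq (w i)) ?undup_uniq //= eqxx mulr1 big1 ?addr0 // => v.
  by rewrite eq_sym => /negbTE->; rewrite mulr0 scale0r.
rewrite exchange_big big1 //= => v _.
have /(congr1 (mcoeff v)) := rel0; rewrite raddf_sum mcoeff0 /= => rel_v.
rewrite -scaler_suml [X in X *: _](_ : _ = 0) ?scale0r // -[RHS]rel_v.
by apply: eq_bigr => i _; rewrite mcoeffZ mcoeffX.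
Qed.

Lemma mxvec_index_eq m n (i i' : 'I_m) (j j' : 'I_n) :
  (mxvec_index i j == mxvec_index i' j') = (i == i') && (j == j').
Proof.
by rewrite (inj_eq (@cast_ord_inj _ _ _)) (inj_eq enum_rank_inj) xpair_eqE.
Qed.

Lemma mpolyX_sum (R : comNzRingType) (N : nat) (I : Type) (s : seq I)
    (F : I -> 'X_{1..N}) :
  'X_[(\sum_(i <- s) F i)%MM] = \prod_(i <- s) 'X_[F i] :> {mpoly R[N]}.
Proof. by apply: (big_morph _ (@mpolyXD N R)); apply: mpolyX0. Qed.

(** * Tableaux under the matching field map *)

Section MatchingFieldIdeal.
Variables (K : fieldType) (k n l : nat).
Implicit Types (T : seq (ksub k n)).
Local Notation L := (block_diagonal k n l).
Local Notation entry := (entry l).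

(** Carrying the sign makes the image a monomial with coefficient 1. *)
Definition signed_var (I : ksub k n) : Pring K k n :=
  (-1) ^+ (L I : bool) *: 'X_(enum_rank I).

Definition table_mon T : Pring K k n := \prod_(D <- T) signed_var D.

Definition entry_mnm (I : ksub k n) : 'X_{1..k * n} :=
  (\sum_(r < k) U_(mxvec_index r (entry I r)))%MM.

Definition table_mnm T := (\sum_(D <- T) entry_mnm D)%MM.

HB.instance Definition _ := GRing.RMorphism.copy (matching_map K L)
  (mmap (@mpolyC (k * n)%N K)
    (fun a => let I := enum_val a in
              (-1) ^+ (L I : bool) * matching_monomial K L I)).

Lemma matching_mapZ c p : matching_map K L (c *: p) = c *: matching_map K L p.
Proof. by rewrite /matching_map mmapZ mul_mpolyC. Qed.

Lemma matching_map_signed_var I :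
  matching_map K L (signed_var I) = 'X_[entry_mnm I].
Proof.
rewrite matching_mapZ /matching_map mmapX mmap1U enum_rankK /=.
rewrite -mul_mpolyC rmorph_sign mulrA -signr_addb addbb mul1r.
rewrite /matching_monomial /entry_mnm mpolyX_sum.
(* Passing from ranks in [I] to rows inverts the permutation [L I]. *)
rewrite (reindex_inj (@perm_inj _ (L I)^-1%g)) /=.
by apply: eq_bigr => r _; rewrite permKV.
Qed.

Lemma matching_map_table T : matching_map K L (table_mon T) = 'X_[table_mnm T].
Proof.
rewrite rmorph_prod /= /table_mnm mpolyX_sum.
by apply: eq_bigr => I _; apply: matching_map_signed_var.
Qed.

Lemma table_mnm_rows T T' :
  table_mnm T = table_mnm T' <-> same_rows l T T'.
Proof.
have E S : table_mnm S =
    (\sum_(r < k) \sum_(x <- [seq entry D r | D <- S]) U_(mxvec_index r x))%MM.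
  rewrite /table_mnm /entry_mnm exchange_big /=.
  by apply: eq_bigr => r _; rewrite big_map.
split=> [eTT' r|TT']; last first.
  by rewrite !E; apply: eq_bigr => r _; apply: perm_big.
(* The exponent of [x_(r,x)] counts the entries equal to [x] in row [r]. *)
have cnt S x : table_mnm S (mxvec_index r x) =
    count_mem x [seq entry D r | D <- S].
  rewrite E mnm_sumE (bigD1 r) //= [X in (_ + X)%N]big1 ?addn0 => [|s sr].
    rewrite mnm_sumE -sum1_count [RHS]big_mkcond /=.
    by apply: eq_bigr => y _; rewrite mnm1E mxvec_index_eq eqxx; case: (y == x).
  by rewrite mnm_sumE big1 // => y _; rewrite mnm1E mxvec_index_eq (negbTE sr).
by apply/allP => x _ /=; rewrite -!cnt eTT'.
Qed.

Lemma signed_var_homog I : signed_var I \is 1.-homog.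
Proof. by rewrite rpredZ // dhomogX; apply/eqP/mdeg1. Qed.

Definition quadric (g : Pring K k n) :=
  g \is 2.-homog /\ matching_ideal K L g.

(** A pair step changes the product by a monomial times a quadratic binomial of the kernel; chains
    telescope. *)
Lemma quad_conn_ideal T T' : quad_conn l T T' ->
  ideal_gen quadric (table_mon T - table_mon T').
Proof.
elim=> {T T'} [T T' TT'|I J I' J' T IJ|T1 T2 T3 _ T12 _ T23].
- by rewrite /table_mon (perm_big _ TT') subrr; apply: ideal_gen0.
- have -> : table_mon [:: I, J & T] - table_mon [:: I', J' & T] =
      table_mon T * (table_mon [:: I; J] - table_mon [:: I'; J']).
    by rewrite /table_mon !big_cons big_nil !mulr1; ring.
  apply/ideal_genM/ideal_gen_mem; split.
    rewrite /table_mon !big_cons big_nil !mulr1.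
    by rewrite rpredB // (dhomogM (d := 1%N) (e := 1%N)) // signed_var_homog.
  rewrite /matching_ideal rmorphB /= !matching_map_table.
  by rewrite ((table_mnm_rows _ _).2 IJ) subrr.
- rewrite -(subrK (table_mon T2) (table_mon T1)) -addrA.
  exact: ideal_genD.
Qed.

Lemma mpolyX_table (m : 'X_{1..#|{: ksub k n}|}) :
  exists c T, 'X_[m] = c *: table_mon T.
Proof.
rewrite mpolyXE_id; elim/big_rec: _ => [|a p _ [c [T ->]]].
  by exists 1, [::]; rewrite /table_mon big_nil scale1r.
elim: (m a) => [|d [c' [T' IH]]]; first by exists c, T; rewrite mul1r.
exists ((-1) ^+ (L (enum_val a) : bool) * c'), (enum_val a :: T').
rewrite exprS -mulrA {}IH /table_mon big_cons /signed_var enum_valK.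
rewrite -!scalerAr -!scalerAl !scalerA; congr (_ *: _).
by rewrite mulrAC -signr_addb addbb mul1r.
Qed.

Lemma mpoly_table (p : Pring K k n) : exists s : seq (K * seq (ksub k n)),
  p = \sum_(u <- s) u.1 *: table_mon u.2.
Proof.
rewrite (mpolyE p); elim: (msupp p) => [|m ms [s IH]].
  by exists [::]; rewrite !big_nil.
have [c [T mE]] := mpolyX_table m.
by exists ((p@_m * c, T) :: s); rewrite !big_cons IH mE scalerA.
Qed.

Lemma matching_ideal_quadric (k_gt0 : (0 < k)%N) (p : Pring K k n) :
  matching_ideal K L p -> ideal_gen quadric p.
Proof.
have [s ->] := mpoly_table p; rewrite /matching_ideal rmorph_sum /= => rel0.
(* [rep w] is the first listed tableau with exponent [w]; the default [[::]] is never reached for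
   exponents occurring in [s]. *)
pose rep w := nth [::] [seq u.2 | u <- s]
  (find (fun T => table_mnm T == w) [seq u.2 | u <- s]).
have rel_rep : \sum_(u <- s) u.1 *: table_mon (rep (table_mnm u.2)) = 0.
  apply: (mpolyX_relation (fun w => table_mon (rep w))).
  rewrite -[RHS]rel0; apply: eq_bigr => u _.
  by rewrite matching_mapZ matching_map_table.
(* Subtracting the vanishing sum over representatives leaves differences of tableaux with the same
   rows. *)
rewrite -[X in ideal_gen _ X]subr0 -{2}rel_rep -sumrB big_seq.
elim/big_rec: _ => [|u q us qJ]; first exact: ideal_gen0.
apply: ideal_genD qJ; rewrite -scalerBr -mul_mpolyC; apply: ideal_genM.
apply/quad_conn_ideal/(same_rows_quad_conn k_gt0)/table_mnm_rows/esym/eqP.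
have has_u : has (fun T => table_mnm T == table_mnm u.2) [seq v.2 | v <- s].
  by apply/hasP; exists u.2; rewrite ?map_f.
exact: (nth_find [::] has_u).
Qed.

End MatchingFieldIdeal.

Local Close Scope ring_scope.

Theorem theorem4p1 (K : fieldType) (charK0 : [pchar K]%R =i pred0)
    (k n l : nat) (k_gt0 : 1 <= k) (le_kn : k <= n) (le_ln : l <= n) :
  quadratically_generated (matching_ideal K (block_diagonal k n l)).
Proof.
exists (quadric l); split=> [g [] //|p]; split.
  exact: matching_ideal_quadric.
(* The converse inclusion holds because a kernel is an ideal. *)
case=> s sG ->; rewrite /matching_ideal rmorph_sum /= big_seq big1 // => u us.
by have [_ u0] := sG u us; rewrite rmorphM /= u0 mulr0.
Qed.
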